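(* The only four-dimensional nilpotent subalgebra of $\mathfrak{b}$ is $\mathfrak{n}$.
   Context: Let $J=\begin{pmatrix}0&0&1&0\\0&0&0&1\\-1&0&0&0\\0&-1&0&0\end{pmatrix}$. $\mathfrak{sp}(4,\mathbb{C})$ is the Lie algebra of $4\times4$ complex matrices $X$ with $JX^tJ=X$. For $a,b\in\mathbb{C}$, $T_{a,b}=\mathrm{diag}(a,b,-a,-b)$, and $\mathfrak{t}=\{T_{a,b}: a,b\in\mathbb{C}\}$. With $E_{ij}$ the matrix units, $X_\alpha=E_{24}$, $X_\beta=E_{12}-E_{43}$, $X_{\alpha+\beta}=E_{14}+E_{23}$, $X_{\alpha+2\beta}=E_{13}$. $\mathfrak{n}$ is the complex linear span of $X_\alpha,X_\beta,X_{\alpha+\beta},X_{\alpha+2\beta}$, and $\mathfrak{b}=\mathfrak{t}\oplus\mathfrak{n}$ is the Borel subalgebra of $\mathfrak{sp}(4,\mathbb{C})$. *)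

(* Defs.v *)
From HB Require Import structures.
From mathcomp Require Import all_boot all_order all_algebra.
From mathcomp Require Import complex.
From mathcomp Require Import reals.

Set Implicit Arguments.
Unset Strict Implicit.
Unset Printing Implicit Defensive.

Import Order.TTheory GRing.Theory Num.Theory.
Local Open Scope ring_scope.
Local Open Scope complex_scope.

Section LieMatrix.
Variables (K : fieldType) (n : nat).
Implicit Types (A B : 'M[K]_n) (U V W g h : {vspace 'M[K]_n}).

Definition lie_bracket A B : 'M[K]_n := A *m B - B *m A.

(* [U, V], the span of all brackets of elements of U and V; bases suffice by
   bilinearity, see lie_prodvP. *)
Definition lie_prodv U V : {vspace 'M[K]_n} :=
  <<[seq lie_bracket A B | A <- vbasis U, B <- vbasis V]>>%VS.

Lemma lie_prodvP U V W :
  reflect (forall A B, A \in U -> B \in V -> lie_bracket A B \in W)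
          (lie_prodv U V <= W)%VS.
Proof.
apply: (iffP idP) => [/subvP sUVW A B UA VB | sUVW].
  rewrite (coord_vbasis UA) /lie_bracket mulmx_suml mulmx_sumr -sumrB.
  apply: memv_suml => i _; rewrite (coord_vbasis VB) mulmx_suml mulmx_sumr.
  rewrite -sumrB; apply: memv_suml => j _.
  rewrite -!scalemxAl -!scalemxAr !scalerA [X in _ - X *: _]mulrC -scalerBr.
  by apply/memvZ/sUVW/memv_span/allpairs_f; rewrite mem_nth ?size_tuple.
apply/span_subvP => _ /allpairsP[[A B] [/= UA VB ->]].
by apply: sUVW; apply: vbasis_mem.
Qed.

Lemma memv_lie U V A B :
  A \in U -> B \in V -> lie_bracket A B \in lie_prodv U V.
Proof. by move=> UA VB; apply: (lie_prodvP U V _ (subvv _)). Qed.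

Definition lie_subalgebra h g : Prop :=
  (h <= g)%VS /\ forall A B, A \in h -> B \in h -> lie_bracket A B \in h.

Fixpoint lower_central g (k : nat) : {vspace 'M[K]_n} :=
  if k is k'.+1 then lie_prodv g (lower_central g k') else g.

Definition lie_nilpotent g : Prop := exists k, lower_central g k = 0%VS.

End LieMatrix.

Section Sp4.
Variable R : realType.
Local Notation C := R[i].

Definition Jmx : 'M[C]_4 := @block_mx C 2 2 2 2 0 1%:M (- 1%:M) 0.

Definition sp4_defect (X : 'M[C]_4) : 'M[C]_4 := Jmx *m X^T *m Jmx - X.

Lemma sp4_defect_linear : linear sp4_defect.
Proof.
move=> a X Y; rewrite /sp4_defect linearP mulmxDr mulmxDl -scalemxAr -scalemxAl.
by rewrite scalerBr opprD addrACA.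
Qed.

HB.instance Definition _ :=
  GRing.isLinear.Build C 'M[C]_4 'M[C]_4 _ sp4_defect sp4_defect_linear.

Definition sp4 : {vspace 'M[C]_4} := lker (linfun sp4_defect).

Lemma mem_sp4 (X : 'M[C]_4) : X \in sp4 <-> Jmx *m X^T *m Jmx = X.
Proof.
rewrite memv_ker lfunE /= subr_eq0; by split => /eqP.
Qed.

(* The matrix unit E_ij, with 1 <= i, j <= 4. *)
Definition Eij (i j : nat) : 'M[C]_4 := delta_mx (inord i.-1) (inord j.-1).

Definition Tab (a b : C) : 'M[C]_4 :=
  diag_mx (\row_(j < 4) [:: a; b; - a; - b]`_j).

Definition torus : {vspace 'M[C]_4} := <<[:: Tab 1%R 0%R; Tab 0%R 1%R]>>%VS.

Definition Xalpha : 'M[C]_4 := Eij 2 4.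
Definition Xbeta : 'M[C]_4 := Eij 1 2 - Eij 4 3.
Definition Xalphabeta : 'M[C]_4 := Eij 1 4 + Eij 2 3.
Definition Xalpha2beta : 'M[C]_4 := Eij 1 3.

Definition nilrad : {vspace 'M[C]_4} :=
  <<[:: Xalpha; Xbeta; Xalphabeta; Xalpha2beta]>>%VS.

Definition borel : {vspace 'M[C]_4} := (torus + nilrad)%VS.

Lemma TabE a b : Tab a b = a *: Tab 1 0 + b *: Tab 0 1.
Proof.
apply/matrixP => i j; rewrite !mxE.
case: (i == j); last by rewrite !mulr0n !mulr0 addr0.
rewrite !mulr1n; case: i => [[|[|[|[|//]]]] Hi] /=;
  by rewrite ?(oppr0, mulrN, mulr1, mulr0, addr0, add0r).
Qed.

Lemma torusP (X : 'M[C]_4) : X \in torus <-> exists a b, X = Tab a b.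
Proof.
rewrite /torus span_cons span_seq1; split.
  case/memv_addP => _ /vlineP[a ->] [_ /vlineP[b ->] ->].
  by exists a, b; rewrite [RHS]TabE.
case=> a [b ->]; rewrite TabE memv_add // memvZ // memv_line //.
Qed.

Lemma borel_direct : directv (torus + nilrad).
Proof.
apply/directv_addP/eqP; rewrite -subv0; apply/subvP => X.
rewrite memv_cap => /andP[/torusP[a [b ->]]] nX.
have diag0 (Y : 'M[C]_4) i : Y \in nilrad -> Y i i = 0.
  rewrite /nilrad !span_cons span_nil addv0.
  case/memv_addP => _ /vlineP[x1 ->] [_ /memv_addP[_ /vlineP[x2 ->] [Z nZ ->]] ->].
  case/memv_addP: nZ => _ /vlineP[x3 ->] [_ /vlineP[x4 ->] ->].
  rewrite !mxE -!val_eqE /= !inordK //.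
  by case: i => [[|[|[|[|//]]]] Hi] /=;
     rewrite ?(mulr0, mulr0n, oppr0, addr0, subr0).
have := diag0 _ 0 nX; have := diag0 _ 1 nX.
rewrite !mxE /= !mulr1n => b0 a0.
by rewrite b0 a0 TabE !scale0r addr0 mem0v.
Qed.

Lemma borel_sp4 : (borel <= sp4)%VS.
Proof.
have JE (X : 'M[C]_4) (i j : 'I_4) : (Jmx *m X^T *m Jmx) i j =
    (-1) ^+ ((i < 2) (+) (2 <= j))%N
      * X (inord ((j + 2) %% 4)%N) (inord ((i + 2) %% 4)%N).
  have JmxE (k l : 'I_4) :
      Jmx k l = (l == (k + 2)%N :> nat)%:R - (k == (l + 2)%N :> nat)%:R.
    rewrite /Jmx !mxE; case: splitP => k' Ek; rewrite !mxE;
      case: splitP => l' El; rewrite !mxE Ek El -?val_eqE /=;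
      case: k' {Ek} => [[|[|//]] ?]; case: l' {El} => [[|[|//]] ?] /=;
      by rewrite ?(addr0, mulr0n, mulr1n, subr0, sub0r, oppr0).
  rewrite mxE (bigD1 (inord ((j + 2) %% 4)%N)) //= big1 => [|k nk].
    rewrite addr0 mxE (bigD1 (inord ((i + 2) %% 4)%N)) //= big1 => [|l nl].
      rewrite addr0 !JmxE [X^T _ _]mxE !inordK ?ltn_pmod //.
      case: i => [[|[|[|[|//]]]] ?]; case: j => [[|[|[|[|//]]]] ?] /=;
        by rewrite ?(mulr0n, mulr1n, subr0, sub0r, expr0, expr1, mul1r, mulr1, mulN1r, mulrN1, opprK).
    suff -> : Jmx i l = 0 by rewrite mul0r.
    rewrite JmxE; move: nl; rewrite -val_eqE /= inordK ?ltn_pmod //.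
    by case: i => [[|[|[|[|//]]]] ?]; case: l => [[|[|[|[|//]]]] ?] //=;
       rewrite subr0.
  suff -> : Jmx k j = 0 by rewrite mulr0.
  rewrite JmxE; move: nk; rewrite -val_eqE /= inordK ?ltn_pmod //.
  by case: j => [[|[|[|[|//]]]] ?]; case: k => [[|[|[|[|//]]]] ?] //=;
     rewrite subr0.
have gen (X : 'M[C]_4) : (forall i j : 'I_4, (-1) ^+ ((i < 2) (+) (2 <= j))%N
      * X (inord ((j + 2) %% 4)%N) (inord ((i + 2) %% 4)%N) = X i j) -> X \in sp4.
  by move=> XE; apply/mem_sp4/matrixP => i j; rewrite JE.
rewrite subv_add; apply/andP; split; apply/span_subvP => X.
  rewrite !inE => /orP[] /eqP ->; apply: gen => i j;
    rewrite !mxE -!val_eqE /= !inordK ?ltn_pmod //;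
    case: i => [[|[|[|[|//]]]] ?]; case: j => [[|[|[|[|//]]]] ?] /=;
    by rewrite ?(mulr0n, mulr1n, oppr0, opprK, subr0, sub0r, expr0, expr1,
                 mul1r, mulr0, mulr1, mulN1r, mulrN1).
rewrite !inE => /or4P[] /eqP ->; apply: gen => i j;
  rewrite !mxE -!val_eqE /= !inordK ?ltn_pmod //;
  case: i => [[|[|[|[|//]]]] ?]; case: j => [[|[|[|[|//]]]] ?] /=;
  by rewrite ?(mulr0n, mulr1n, oppr0, opprK, subr0, sub0r, expr0, expr1,
               mul1r, mulr0, mulr1, mulN1r, mulrN1, addr0, add0r).
Qed.

End Sp4.

(* Main.v *)
Require Import Defs.
From HB Require Import structures.
From mathcomp Require Import all_boot all_order all_algebra.
From mathcomp Require Import complex.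
From mathcomp Require Import reals.
From mathcomp Require Import ring.
Import GRing.Theory.
Local Open Scope ring_scope.
Local Open Scope complex_scope.

(** Suppose that a nilpotent subalgebra [h] of the Borel subalgebra contains an
    element [X] with nonzero torus part [T]. Every element of [h] is killed by a
    power of [ad X]. On the nilradical, [ad X] is triangular with diagonal
    entries the values at [T] of the four positive roots, and at most one of
    these vanishes, since any two positive roots are independent. So [h] meets
    trivially the 3-dimensional space of nilradical elements with zero
    coordinate at the vanishing root, and [\dim h <= 6 - 3]. Hence a
    4-dimensional [h] lies in the nilradical. *)

Lemma iter_lie_bracket_lower_central (K : fieldType) (n : nat)
    (h : {vspace 'M[K]_n}) (X Y : 'M[K]_n) (k : nat) :
  X \in h -> Y \in h -> iter k (lie_bracket X) Y \in lower_central h k.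
Proof. by move=> hX hY; elim: k => //= k IHk; apply: memv_lie. Qed.

(** Rank-nullity: a linear form has image of dimension at most one. *)
Lemma dim_capv_lker_form (K : fieldType) (vT : vectType K) (U : {vspace vT})
    (f : 'Hom(vT, K^o)) : (\dim U <= (\dim (U :&: lker f)).+1)%N.
Proof.
rewrite -(limg_ker_dim f U) -addn1 leq_add2l.
by have := dimvS (subvf (f @: U)); rewrite dimvf.
Qed.

Section Borel.
Variable R : realType.
Local Notation C := R[i].

(** Coordinates [x1], [x2], [x3], [x4] belong to the roots alpha, beta, alpha+beta, alpha+2beta.
    Explicit entries turn brackets into [ring] identities. *)
Definition borel_mx (a b x1 x2 x3 x4 : C) : 'M[C]_4 :=
  \matrix_(i < 4, j < 4)
    nth 0 (nth [::] [:: [:: a; x2; x4; x3];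
                        [:: 0; b; x3; x1];
                        [:: 0; 0; - a; 0];
                        [:: 0; 0; - x2; - b]] i) j.

Lemma borel_mxE a b x1 x2 x3 x4 :
  borel_mx a b x1 x2 x3 x4 =
  Tab a b + (x1 *: Xalpha R + (x2 *: Xbeta R +
    (x3 *: Xalphabeta R + x4 *: Xalpha2beta R))).
Proof.
apply/matrixP => i j; rewrite !mxE -!val_eqE /= !inordK //.
by case: i => [[|[|[|[|//]]]] ?]; case: j => [[|[|[|[|//]]]] ?] /=; ring.
Qed.

Lemma mem_nilrad (X : 'M[C]_4) :
  X \in nilrad R <->
  exists x1 x2 x3 x4, X = borel_mx 0 0 x1 x2 x3 x4.
Proof.
have bE x1 x2 x3 x4 : borel_mx 0 0 x1 x2 x3 x4 =
    x1 *: Xalpha R + (x2 *: Xbeta R +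
      (x3 *: Xalphabeta R + x4 *: Xalpha2beta R)).
  by rewrite borel_mxE TabE !scale0r !add0r.
rewrite /nilrad !span_cons span_nil addv0; split.
  case/memv_addP => _ /vlineP[x1 ->] [_ /memv_addP[_ /vlineP[x2 ->] [Z nZ ->]] ->].
  case/memv_addP: nZ => _ /vlineP[x3 ->] [_ /vlineP[x4 ->] ->].
  by exists x1, x2, x3, x4; rewrite bE.
case=> x1 [x2 [x3 [x4 ->]]]; rewrite bE.
by rewrite !memv_add // memvZ // memv_line.
Qed.

Lemma mem_borel (X : 'M[C]_4) :
  X \in borel R -> exists a b x1 x2 x3 x4, X = borel_mx a b x1 x2 x3 x4.
Proof.
case/memv_addP => _ /torusP[a [b ->]] [_ /mem_nilrad[x1 [x2 [x3 [x4 ->]]]] ->].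
exists a, b, x1, x2, x3, x4.
by rewrite !borel_mxE (TabE 0 0) !scale0r !add0r.
Qed.

(** The factors [2 * b], [a - b], [a + b], [2 * a] are the values of the four roots at [Tab a b];
    the other terms come from [X_beta, X_alpha] = X_{alpha+beta} and [X_beta, X_{alpha+beta}] = 2
    X_{alpha+2beta}. *)
Lemma lie_bracket_borel_mx a b x1 x2 x3 x4 a' b' y1 y2 y3 y4 :
  lie_bracket (borel_mx a b x1 x2 x3 x4) (borel_mx a' b' y1 y2 y3 y4) =
  borel_mx 0 0 (2 * b * y1 - 2 * b' * x1)
    ((a - b) * y2 - (a' - b') * x2)
    ((a + b) * y3 - (a' + b') * x3 + x2 * y1 - x1 * y2)
    (2 * a * y4 - 2 * a' * x4 + 2 * x2 * y3 - 2 * x3 * y2).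
Proof.
apply/matrixP => i j; rewrite !mxE !big_ord_recl !big_ord0 !mxE /=.
by case: i => [[|[|[|[|//]]]] ?]; case: j => [[|[|[|[|//]]]] ?] /=; ring.
Qed.

Lemma borel_mx_inj a b x1 x2 x3 x4 a' b' y1 y2 y3 y4 :
  borel_mx a b x1 x2 x3 x4 = borel_mx a' b' y1 y2 y3 y4 ->
  [/\ x1 = y1, x2 = y2, x3 = y3 & x4 = y4].
Proof.
move=> /matrixP E.
have := E (inord 1) (inord 3); have := E (inord 0) (inord 1).
have := E (inord 0) (inord 3); have := E (inord 0) (inord 2).
by rewrite !mxE !inordK.
Qed.

Lemma borel_mx0 : borel_mx 0 0 0 0 0 0 = 0.
Proof. by rewrite borel_mxE TabE !scale0r !addr0. Qed.

(* Triangularity of [ad X] on the nilradical, filtered by root height: the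
   leading coordinate is multiplied by the value of its root. *)
Lemma iter_lie_bracket_eq0 a b x1 x2 x3 x4 k y1 y2 y3 y4 :
  iter k (lie_bracket (borel_mx a b x1 x2 x3 x4)) (borel_mx 0 0 y1 y2 y3 y4)
    = 0 ->
  [/\ (2 * b) ^+ k * y1 = 0, (a - b) ^+ k * y2 = 0,
      y1 = 0 -> y2 = 0 -> (a + b) ^+ k * y3 = 0 &
      y1 = 0 -> y2 = 0 -> y3 = 0 -> (2 * a) ^+ k * y4 = 0].
Proof.
elim: k y1 y2 y3 y4 => [|k IHk] y1 y2 y3 y4.
  rewrite /= -borel_mx0 => /borel_mx_inj[-> -> -> ->].
  by rewrite !mulr0.
(* The innermost bracket lies in the nilradical again, so the induction hypothesis applies to its
   coordinates. *)
rewrite iterSr lie_bracket_borel_mx => /IHk[E1 E2 E3 E4]; split.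
- by rewrite -[RHS]E1 exprS; ring.
- by rewrite -[RHS]E2 exprS; ring.
- by move=> y10 y20; rewrite -[RHS]E3 ?y10 ?y20 ?exprS; ring.
- by move=> y10 y20 y30; rewrite -[RHS]E4 ?y10 ?y20 ?y30 ?exprS; ring.
Qed.

(** The cases leave open, in order, the value of alpha, beta, alpha+beta, alpha+2beta. *)
Lemma at_most_one_root_eq0 (a b : C) : (a, b) != (0, 0) ->
  [\/ [/\ a - b != 0, a + b != 0 & 2 * a != 0],
      [/\ 2 * b != 0, a + b != 0 & 2 * a != 0],
      [/\ 2 * b != 0, a - b != 0 & 2 * a != 0] |
      [/\ 2 * b != 0, a - b != 0 & a + b != 0]].
Proof.
have n2 : (2 : C) != 0 by rewrite Num.Theory.pnatr_eq0.
rewrite xpair_eqE !mulf_eq0 !(negbTE n2) /=.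
have [->|a0] := eqVneq a 0 => /= b0.
  by apply: Or44; rewrite sub0r add0r oppr_eq0 b0.
have [->|{}b0] := eqVneq b 0; first by apply: Or41; rewrite subr0 addr0 a0.
have [ab|ab] := eqVneq (a - b) 0; last by apply: Or43.
apply: Or42; split=> //; rewrite (subr0_eq ab) -mulr2n -mulr_natl.
by rewrite mulf_neq0.
Qed.

Lemma dim_nilrad : \dim (nilrad R) = 4%N.
Proof.
(* [free] unfolds to equality of the dimension of the span with the length of the list. *)
apply/eqP; change (free [:: Xalpha R; Xbeta R; Xalphabeta R; Xalpha2beta R]).
apply/(freeP (X := [tuple Xalpha R; Xbeta R; Xalphabeta R; Xalpha2beta R])) => k.
rewrite !big_ord_recl big_ord0 addr0 /= => E.
set k0 := k ord0 in E; set k1 := k _ in E; set k2 := k _ in E; set k3 := k _ in E.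
have: borel_mx 0 0 k0 k1 k2 k3 = borel_mx 0 0 0 0 0 0.
  by rewrite borel_mx0 borel_mxE TabE !scale0r !add0r.
case/borel_mx_inj => E0 E1 E2 E3 i.
case: i => [[|[|[|[|//]]]] Hi]; [rewrite -[RHS]E0|rewrite -[RHS]E1|
  rewrite -[RHS]E2|rewrite -[RHS]E3]; congr (k _); exact: val_inj.
Qed.

Lemma dim_borel : (\dim (borel R) <= 6)%N.
Proof.
apply: leq_trans (dimv_add_leqif _ _) _.
by rewrite dim_nilrad (leq_add2r 4 _ 2); apply: dim_span.
Qed.

(** The codomain [C^o] makes the entry a linear form, whose kernel imposes the vanishing of one root
    coordinate. *)
Definition entry_form (i j : 'I_4) (X : 'M[C]_4) : C^o := X i j.

Lemma entry_form_is_linear i j : linear (entry_form i j).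
Proof. by move=> a X Y; rewrite /entry_form !mxE. Qed.

HB.instance Definition _ i j :=
  GRing.isLinear.Build C 'M[C]_4 C^o _ (entry_form i j)
    (entry_form_is_linear i j).

Lemma nilpotent_sub_nilrad (h : {vspace 'M[C]_4}) :
  (h <= borel R)%VS -> lie_nilpotent h -> (3 < \dim h)%N ->
  (h <= nilrad R)%VS.
Proof.
move=> hb [k hk] dh; apply/subvP => X hX.
have [a [b [x1 [x2 [x3 [x4 EX]]]]]] := mem_borel X (subvP hb X hX).
have [[a0 b0]|ab0] := eqVneq (a, b) (0, 0).
  by apply/mem_nilrad; exists x1, x2, x3, x4; rewrite EX a0 b0.
exfalso.
(* If no nonzero nilradical element with zero entry at [(i, j)] is killed by the [k]-th power of
   [ad X], then [U], of dimension at least 3, meets [h] trivially, and [h + U] has dimension at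
   least 7 inside [borel R]. *)
have small (i j : 'I_4) : (forall y1 y2 y3 y4,
    let Y := borel_mx 0 0 y1 y2 y3 y4 in
    iter k (lie_bracket X) Y = 0 -> Y i j = 0 -> Y = 0) -> False.
  move=> inj; pose U := (nilrad R :&: lker (linfun (entry_form i j)))%VS.
  have hU0 : (h :&: U)%VS = 0%VS.
    apply/eqP; rewrite -subv0; apply/subvP => Y.
    rewrite !memv_cap memv_ker lfunE /= => /and3P[hY].
    case/mem_nilrad => y1 [y2 [y3 [y4 EY]]] /eqP Y0.
    rewrite memv0 EY; apply/eqP/inj; rewrite -EY //.
    by apply/eqP; rewrite -memv0 -hk; apply: iter_lie_bracket_lower_central.
  have := dim_capv_lker_form _ _ (nilrad R) (linfun (entry_form i j)).
  rewrite -/U dim_nilrad ltnS => dU.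
  have : (4 + 3 <= \dim (h + U))%N by rewrite dimv_disjoint_sum // leq_add.
  apply/negP; rewrite -ltnNge ltnS; apply: leq_trans dim_borel; apply: dimvS.
  rewrite subv_add hb /=; apply: subv_trans (capvSl _ _) _.
  exact: addvSr.
have reg (c y : C) : c != 0 -> c ^+ k * y = 0 -> y = 0.
  by move=> c0 /eqP; rewrite mulf_eq0 expf_eq0 (negbTE c0) andbF => /eqP.
rewrite EX in small.
have [[n2 n3 n4]|[n1 n3 n4]|[n1 n2 n4]|[n1 n2 n3]] := at_most_one_root_eq0 _ _ ab0.
(* In each case the chosen entry carries the coordinate of the root that may vanish; the other
   coordinates are then killed by increasing height. *)
- apply: (small (inord 1) (inord 3)) => y1 y2 y3 y4 Y.
  rewrite mxE !inordK //= => /iter_lie_bracket_eq0[_ E2 E3 E4] y10.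
  have y20 := reg _ _ n2 E2; have y30 := reg _ _ n3 (E3 y10 y20).
  by rewrite /Y y10 y20 y30 (reg _ _ n4 (E4 y10 y20 y30)) borel_mx0.
- apply: (small (inord 0) (inord 1)) => y1 y2 y3 y4 Y.
  rewrite mxE !inordK //= => /iter_lie_bracket_eq0[E1 _ E3 E4] y20.
  have y10 := reg _ _ n1 E1; have y30 := reg _ _ n3 (E3 y10 y20).
  by rewrite /Y y10 y20 y30 (reg _ _ n4 (E4 y10 y20 y30)) borel_mx0.
- apply: (small (inord 0) (inord 3)) => y1 y2 y3 y4 Y.
  rewrite mxE !inordK //= => /iter_lie_bracket_eq0[E1 E2 _ E4] y30.
  have y10 := reg _ _ n1 E1; have y20 := reg _ _ n2 E2.
  by rewrite /Y y10 y20 y30 (reg _ _ n4 (E4 y10 y20 y30)) borel_mx0.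
- apply: (small (inord 0) (inord 2)) => y1 y2 y3 y4 Y.
  rewrite mxE !inordK //= => /iter_lie_bracket_eq0[E1 E2 E3 _] y40.
  have y10 := reg _ _ n1 E1; have y20 := reg _ _ n2 E2.
  by rewrite /Y y10 y20 y40 (reg _ _ n3 (E3 y10 y20)) borel_mx0.
Qed.

Lemma nilrad_lie_subalgebra : lie_subalgebra (nilrad R) (borel R).
Proof.
split=> [|_ _ /mem_nilrad[x1 [x2 [x3 [x4 ->]]]] /mem_nilrad[y1 [y2 [y3 [y4 ->]]]]].
  exact: addvSr.
by rewrite lie_bracket_borel_mx; apply/mem_nilrad; do 4!eexists.
Qed.

(** Brackets add root heights. The successive terms of the lower central series start at heights 1,
    2, 3, and no root has height above 3. *)
Lemma nilrad_lie_nilpotent : lie_nilpotent (nilrad R).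
Proof.
have bE x3 x4 :
    borel_mx 0 0 0 0 x3 x4 = x3 *: Xalphabeta R + x4 *: Xalpha2beta R.
  by rewrite borel_mxE TabE !scale0r !add0r.
have L1 : (lower_central (nilrad R) 1 <= <[Xalphabeta R]> + <[Xalpha2beta R]>)%VS.
  apply/lie_prodvP => _ B /mem_nilrad[x1 [x2 [x3 [x4 ->]]]].
  case/mem_nilrad=> [y1 [y2 [y3 [y4 ->]]]].
  rewrite lie_bracket_borel_mx !(mulr0, mul0r, subr0) bE.
  by rewrite memv_add // memvZ // memv_line.
have L2 : (lower_central (nilrad R) 2 <= <[Xalpha2beta R]>)%VS.
  apply/lie_prodvP => _ Y /mem_nilrad[x1 [x2 [x3 [x4 ->]]]] /(subvP L1).
  case/memv_addP => _ /vlineP[y3 ->] [_ /vlineP[y4 ->] ->].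
  rewrite -bE lie_bracket_borel_mx !(mulr0, mul0r, subr0, addr0) bE scale0r add0r.
  by rewrite memvZ // memv_line.
exists 3%N; apply/eqP; rewrite -subv0.
(* A zero multiple of [Xalphabeta] is inserted below so that [bE] applies. *)
apply/lie_prodvP => _ Y /mem_nilrad[x1 [x2 [x3 [x4 ->]]]] /(subvP L2).
case/vlineP => y4 ->; rewrite -[_ *: _]add0r -(scale0r (Xalphabeta R)) -bE.
by rewrite lie_bracket_borel_mx !(mulr0, mul0r, subr0, addr0) borel_mx0 mem0v.
Qed.

End Borel.

Theorem theorem8p6 (R : realType) (h : {vspace 'M[R[i]]_4}) :
  (lie_subalgebra h (borel R) /\ lie_nilpotent h /\ \dim h = 4%N)
  <-> h = nilrad R.
Proof.
split=> [[[hb _] [nh dh]]|->].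
  apply/eqP; rewrite eqEdim dim_nilrad dh leqnn andbT.
  by apply: nilpotent_sub_nilrad => //; rewrite dh.
split; [exact: nilrad_lie_subalgebra | split; last exact: dim_nilrad].
exact: nilrad_lie_nilpotent.
Qed.
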